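(* Suppose that polynomials $A,D$ and Laurent polynomials $L_1,L_2$ (which are not polynomials) satisfy the equation $$A\circ L_1=L_2\circ D.$$ Then there exist polynomials $R,\tilde A,\tilde D,W$ and Laurent polynomials $\tilde L_1,\tilde L_2$ such that $$A=R\circ\tilde A,\quad L_2=R\circ\tilde L_2,\quad L_1=\tilde L_1\circ W,\quad D=\tilde D\circ W,\quad\tilde A\circ\tilde L_1=\tilde L_2\circ\tilde D$$ and either $$\tilde A\circ\tilde L_1\sim z^n\circ z^rL(z^n),\qquad\tilde L_2\circ\tilde D\sim z^rL^n(z)\circ z^n,$$ where $L$ is a Laurent polynomial, $r\ge0$, $n\ge1$, and $\gcd(r,n)=1$, or $$\tilde A\circ\tilde L_1\sim T_n\circ D_m,\qquad\tilde L_2\circ\tilde D\sim D_m\circ z^n,$$ where $T_n$ is the $n$th Chebyshev polynomial, $n\ge1$, $m\ge1$, and $\gcd(m,n)=1$.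
   Context: All functions are nonconstant, with complex coefficients. A Laurent polynomial is a rational function all of whose poles lie in $\{0,\infty\}$. $D_m=\frac12\left(z^m+\frac1{z^m}\right)$, and $T_n(\cos\varphi)=\cos n\varphi$. For rational functions, $F_2\circ F_1\sim G_2\circ G_1$ (equivalent decompositions of the same function) means that there is a rational function $\mu$ of degree 1 with $F_2=G_2\circ\mu$, $F_1=\mu^{-1}\circ G_1$. *)

(* Defs.v *)
From HB Require Import structures.
From mathcomp Require Import all_boot all_order all_algebra.
From mathcomp Require Import fraction polydiv closed_field.
From mathcomp Require Import reals trigo.
From mathcomp Require Import complex.

Set Implicit Arguments.
Unset Strict Implicit.
Unset Printing Implicit Defensive.

Import Order.TTheory GRing.Theory Num.Theory.
Local Open Scope ring_scope.
Local Open Scope quotient_scope.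

Notation ratfun K := {fraction {poly K}}.
Notation "p %:F" := (@FracField.tofrac _ p) : ring_scope.

Section RationalFunctions.
Variable K : fieldType.
Implicit Types (F G : ratfun K) (p q : {poly K}).

Definition ratC (c : K) : ratfun K := c%:P%:F.

Definition nonconstant F := ~ exists c : K, F = ratC c.

Definition is_poly F := exists p, F = p%:F.

(* The value p(G) of a polynomial p at a rational function G *)
Definition horner_rat p G : ratfun K :=
  (map_poly ratC p).[G].

(* F \o G; see rat_compE for the independence of the chosen representative
   when G is nonconstant, the only case in which it is meaningful *)
Definition rat_comp F G : ratfun K :=
  horner_rat (frac (repr F)).1 G / horner_rat (frac (repr F)).2 G.

(* Degree as a self-map of the projective line *)
Definition has_degree F (d : nat) :=
  exists p q, [/\ q != 0, coprimep p q, F = p%:F / q%:F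
                & d = (maxn (size p) (size q)).-1].

(* The finite poles; nothing is recorded about the point at infinity *)
Definition pole F (a : K) :=
  forall p q, q != 0 -> F = p%:F / q%:F -> root q a.

Definition laurent F := forall a : K, pole F a -> a = 0.

Definition ratX : ratfun K := 'X%:F.

Definition ratD (m : nat) : ratfun K := 2%:R^-1 * (ratX ^+ m + ratX ^- m).

(* nu is the inverse of mu for composition *)
Definition equiv_decomp (F2 F1 G2 G1 : ratfun K) :=
  exists mu nu : ratfun K,
    [/\ has_degree mu 1, rat_comp mu nu = ratX, rat_comp nu mu = ratX,
        F2 = rat_comp G2 mu & F1 = rat_comp nu G1].

End RationalFunctions.

Notation "F \oR G" := (rat_comp F G) (at level 50, left associativity)
  : ring_scope.
Arguments ratX {K}.
Arguments ratD {K} m.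

Definition chebyshev (R : realType) (n : nat) (T : {poly R[i]}) :=
  forall phi : R, T.[(cos phi)%:C%C] = (cos (n%:R * phi))%:C%C.

Section Facts.
Variable K : closedFieldType.
Implicit Types (F G : ratfun K) (p q : {poly K}).

Fact ratC_is_zmod_morphism : zmod_morphism (@ratC K).
Proof. by move=> a b; rewrite /ratC polyCB tofracB. Qed.
Fact ratC_is_monoid_morphism : monoid_morphism (@ratC K).
Proof.
by split=> [|a b]; rewrite /ratC ?polyC1 ?tofrac1 // polyCM tofracM.
Qed.
HB.instance Definition _ :=
  GRing.isZmodMorphism.Build K (ratfun K) (@ratC K) ratC_is_zmod_morphism.
HB.instance Definition _ :=
  GRing.isMonoidMorphism.Build K (ratfun K) (@ratC K) ratC_is_monoid_morphism.

Lemma horner_ratM p q G :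
  horner_rat (p * q) G = horner_rat p G * horner_rat q G.
Proof. by rewrite /horner_rat (rmorphM (map_poly (@ratC K))) hornerM. Qed.

Lemma horner_rat_neq0 p G :
  nonconstant G -> p != 0 -> horner_rat p G != 0.
Proof.
move=> ncG p0; have [s ->] := closed_field_poly_normal p.
rewrite -mul_polyC horner_ratM mulf_neq0 //.
  rewrite /horner_rat (map_polyC (@ratC K)) hornerC.
  by rewrite tofrac_eq0 polyC_eq0 lead_coef_eq0.
elim: s => [|a s IHs].
  rewrite big_nil /horner_rat (rmorph1 (map_poly (@ratC K))) hornerC.
  exact: oner_neq0.
rewrite big_cons horner_ratM; apply: mulf_neq0 IHs.
rewrite /horner_rat (map_polyXsubC (@ratC K)) hornerXsubC subr_eq0.
by apply/eqP => Ga; apply: ncG; exists a.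
Qed.

Lemma ratfun_repr F :
  exists p q, [/\ q != 0, p = (frac (repr F)).1, q = (frac (repr F)).2
                & F = p%:F / q%:F].
Proof.
exists (frac (repr F)).1, (frac (repr F)).2.
split=> //; first exact: denom_ratioP.
set q := (frac (repr F)).2; set p := (frac (repr F)).1.
have q0 : q != 0 by exact: denom_ratioP.
have qF0 : q%:F != 0 by rewrite tofrac_eq0.
apply: (mulIf qF0); rewrite divfK //.
rewrite -[F]reprK /FracField.tofrac; unlock.
rewrite -[X in X = _]FracField.pi_mul; apply/eqmodP.
rewrite /= FracField.equivfE /FracField.mulf.
rewrite !numden_Ratio ?mulr1 ?mul1r ?oner_neq0 //.
by rewrite mulrC.
Qed.

Lemma tofrac_div_eq p q p' q' : q != 0 -> q' != 0 ->
  p%:F / q%:F = p'%:F / q'%:F -> p * q' = p' * q.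
Proof.
move=> q0 q'0 /eqP; rewrite eqr_div ?tofrac_eq0 // -!tofracM tofrac_eq.
by move/eqP.
Qed.

Lemma rat_compE p q G : nonconstant G -> q != 0 ->
  (p%:F / q%:F) \oR G = horner_rat p G / horner_rat q G.
Proof.
move=> ncG q0; rewrite /rat_comp.
have [p' [q' [q'0 <- <- E]]] := ratfun_repr (p%:F / q%:F).
apply/eqP; rewrite eqr_div ?horner_rat_neq0 // -!horner_ratM.
by rewrite (tofrac_div_eq q0 q'0 E).
Qed.

Lemma laurentP F : laurent F <-> exists p k, F = p%:F / ('X^k)%:F.
Proof.
split=> [LF|[p [k ->]] a /(_ p 'X^k)]; last first.
  by rewrite monic_neq0 ?monicXn // /root hornerXn expf_eq0 => /(_ isT erefl)
    /andP[_ /eqP].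
have [p0 [q0 [q0n0 _ _ EF]]] := ratfun_repr F.
pose g := gcdp p0 q0.
have g0 : g != 0 by rewrite gcdp_eq0 negb_and q0n0 orbT.
pose p := p0 %/ g; pose q := q0 %/ g.
have Ep : p0 = p * g by rewrite divpK // dvdp_gcdl.
have Eq : q0 = q * g by rewrite divpK // dvdp_gcdr.
have qn0 : q != 0 by apply: contraNneq q0n0 => q_0; rewrite Eq q_0 mul0r.
have cpq : coprimep p q by rewrite coprimep_div_gcd // q0n0 orbT.
have {EF Ep Eq}EF : F = p%:F / q%:F.
  rewrite EF Ep Eq !tofracM -mulf_div divff ?mulr1 // tofrac_eq0 //.
have q_roots a : root q a -> a = 0.
  move=> qa; apply: LF => p' q' q'n0 E.
  have /(congr1 (fun r => r.[a])) : p * q' = p' * q.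
    by apply: tofrac_div_eq => //; rewrite -EF.
  rewrite !hornerM (rootP qa) mulr0 => /eqP; rewrite mulf_eq0.
  by rewrite (negPf (coprimep_root _ qa)) // coprimep_sym.
have [s Es] := closed_field_poly_normal q.
have s0 : forall a, a \in s -> a = 0.
  move=> a sa; apply: q_roots.
  by rewrite Es rootZ ?lead_coef_eq0 // root_prod_XsubC.
have Eq : q = lead_coef q *: 'X^(size s).
  rewrite {1}Es; congr (_ *: _).
  elim: s s0 {Es} => [|a s IHs] s0; first by rewrite big_nil expr0.
  rewrite big_cons IHs => [|b sb]; last by apply: s0; rewrite inE sb orbT.
  by rewrite (s0 a) ?mem_head // subr0 -exprS.
have l0 : lead_coef q != 0 by rewrite lead_coef_eq0.
exists ((lead_coef q)^-1 *: p), (size s); rewrite EF.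
apply/eqP; rewrite eqr_div ?tofrac_eq0 // ?monic_neq0 ?monicXn //.
by rewrite -!tofracM tofrac_eq {2}Eq -scalerAl -scalerAr scalerA mulVf // scale1r.
Qed.

End Facts.

(* Main.v *)
Require Import Defs.
From HB Require Import structures.
From mathcomp Require Import all_boot all_order all_algebra all_field.
From mathcomp Require Import fraction reals complex trigo zify ring.

Set Implicit Arguments.
Unset Strict Implicit.
Unset Printing Implicit Defensive.

Import Order.TTheory GRing.Theory Num.Theory.
Local Open Scope ring_scope.

(** Write [F] for the common value of both sides.  Since [L2] is not a
polynomial it has a pole at 0, so every root of [D] is a pole of
[F = A \o L1], hence is 0: thus [D = e *: 'X^d] ([monomial_inner]), and
[A \o L1] is invariant under the rotation [z |-> eps z], with [eps] a
primitive [d]-th root of unity.  Translate [A] so that its subleading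
coefficient vanishes ([exists_center]); with the matching constant [c],
[L1 - c = P / 'X^k] with [P.[0] != 0] and [0 < k].

Let [B] be the translated polynomial, of degree [a].  As [B] has no term of
degree [a - 1], invariance bounds the difference of the [a]-th powers of
[L1 - c] and of its rotation by the terms of degree at most [a - 2], both near
0 and near infinity.  Dividing out a factor that does not cancel, one finds
that, up to a root of unity, [L1 - c] agrees with its rotation to an order as
large as its own pole, at 0 and (if there is a pole) at infinity.  With [N]
the degree of [P], this says that the exponents [j] of [P] satisfy [d %| j]
whenever [j < 2 k], and, if [k < N], [d %| N - j] whenever [2 k < j + N].
Comparing the two ([semi_invariant_shape]), either [P] is a polynomial in ['X^d], or
[N = 2 k] and [P] has only the terms of degrees 0 and [2 k].  The first
possibility gives the power decomposition ([power_case]) and the second, after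
scaling the variable, [ratD] and the Chebyshev one ([binomial_case]).

It remains to write [A] as a polynomial in the left factor [At].  Put
[n = d / gcd(k, d)].  The lowest term at 0 shows that [n] divides the degree
of every nonzero polynomial [C] such that [C \o L1] factors through [D]
([degree_dvd]).  The left factor, either an affine change of ['X^n] or one of
the [n]-th Chebyshev polynomial, is such a polynomial and has degree exactly
[n]; subtracting multiples of its powers expresses every such [C], and in
particular [A], as a polynomial in it ([exists_factor_through], [assemble]). *)

(** * Composition on the right as a field morphism *)

Section Composition.
Variable K : closedFieldType.
Implicit Types (F G H : ratfun K) (p q : {poly K}).

Lemma tofrac_inj : injective (fun p : {poly K} => p%:F).
Proof. by move=> p q /eqP; rewrite tofrac_eq => /eqP. Qed.

Lemma ratfunP F : exists p q, q != 0 /\ F = p%:F / q%:F.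
Proof. by have [p [q [q0 _ _ ->]]] := ratfun_repr F; exists p, q. Qed.

Lemma poly_nonconstantP p : nonconstant p%:F <-> (1 < size p)%N.
Proof.
rewrite ltnNge; split=> [ncp|/negP szp [c /tofrac_inj pc]].
  by apply/negP => /size1_polyC pc; apply: ncp; exists p`_0; rewrite /ratC -pc.
by apply: szp; rewrite pc size_polyC leq_b1.
Qed.

Section FixedRight.
Variables (G : ratfun K) (ncG : nonconstant G).

Lemma rat_comp_polyl p : p%:F \oR G = horner_rat p G.
Proof.
have := rat_compE p ncG (oner_neq0 {poly K}).
by rewrite tofrac1 divr1 /horner_rat rmorph1 hornerC divr1.
Qed.

Lemma rat_compC c : ratC c \oR G = ratC c.
Proof. by rewrite rat_comp_polyl /horner_rat map_polyC hornerC. Qed.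

Fact rat_comp_is_zmod_morphism : zmod_morphism (@rat_comp K ^~ G).
Proof.
move=> F1 F2 /=; have [[p1 [q1 [q10 ->]]] [p2 [q2 [q20 ->]]]] :=
  (ratfunP F1, ratfunP F2).
have -> : p1%:F / q1%:F - p2%:F / q2%:F
        = (p1 * q2 - p2 * q1)%:F / (q1 * q2)%:F.
  by rewrite -mulNr addf_div ?tofrac_eq0 // tofracB !tofracM mulNr.
rewrite !rat_compE ?mulf_neq0 //.
rewrite -[in RHS]mulNr addf_div ?horner_rat_neq0 // mulNr -!horner_ratM.
by rewrite {1}/horner_rat rmorphB hornerD hornerN.
Qed.

Fact rat_comp_is_monoid_morphism : monoid_morphism (@rat_comp K ^~ G).
Proof.
split=> [|F1 F2] /=.
  by have -> : 1 = ratC 1 :> ratfun K; rewrite ?rat_compC // /ratC polyC1 tofrac1.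
have [[p1 [q1 [q10 ->]]] [p2 [q2 [q20 ->]]]] := (ratfunP F1, ratfunP F2).
rewrite mulf_div -!tofracM !rat_compE ?mulf_neq0 //.
by rewrite mulf_div !horner_ratM.
Qed.

End FixedRight.

(** Composition with [G] on the right, carrying the proof that [G] is
nonconstant so that it can be declared a ring morphism. *)
Definition compR G (ncG : nonconstant G) F := F \oR G.

Section CompR.
Variables (G : ratfun K) (ncG : nonconstant G).
HB.instance Definition _ :=
  GRing.isZmodMorphism.Build (ratfun K) (ratfun K) (compR ncG)
    (rat_comp_is_zmod_morphism ncG).
HB.instance Definition _ :=
  GRing.isMonoidMorphism.Build (ratfun K) (ratfun K) (compR ncG)
    (rat_comp_is_monoid_morphism ncG).

Lemma rat_compD F1 F2 : (F1 + F2) \oR G = (F1 \oR G) + (F2 \oR G).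
Proof. exact: (rmorphD (compR ncG)). Qed.
Lemma rat_compB F1 F2 : (F1 - F2) \oR G = (F1 \oR G) - (F2 \oR G).
Proof. exact: (rmorphB (compR ncG)). Qed.
Lemma rat_compM F1 F2 : (F1 * F2) \oR G = (F1 \oR G) * (F2 \oR G).
Proof. exact: (rmorphM (compR ncG)). Qed.
Lemma rat_compXn F n : (F ^+ n) \oR G = (F \oR G) ^+ n.
Proof. exact: (rmorphXn (compR ncG)). Qed.
Lemma rat_compV F : F^-1 \oR G = (F \oR G)^-1.
Proof. exact: (fmorphV (compR ncG)). Qed.
Lemma rat_comp_inj : injective (@rat_comp K ^~ G).
Proof. exact: (fmorph_inj (compR ncG)). Qed.
Lemma rat_comp_ratX : ratX \oR G = G.
Proof. by rewrite rat_comp_polyl // /horner_rat map_polyX hornerX. Qed.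

Lemma horner_rat_comp p H : (horner_rat p H) \oR G = horner_rat p (H \oR G).
Proof.
rewrite -[LHS]/(compR ncG _) /horner_rat -horner_map; congr (_.[_]).
rewrite -map_poly_comp; apply: eq_map_poly => c /=.
exact: rat_compC.
Qed.

Lemma nonconstant_comp F : nonconstant F -> nonconstant (F \oR G).
Proof.
move=> ncF [c Fc]; apply: ncF; exists c; apply: rat_comp_inj.
by rewrite /= Fc rat_compC.
Qed.

Lemma nonconstant_compl F : nonconstant (F \oR G) -> nonconstant F.
Proof. by move=> nc [c Fc]; apply: nc; exists c; rewrite Fc rat_compC. Qed.

Lemma rat_comp_assoc F H : nonconstant H -> (F \oR H) \oR G = F \oR (H \oR G).
Proof.
move=> ncH; have [p [q [q0 ->]]] := ratfunP F.
have ncHG := nonconstant_comp ncH.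
by rewrite !rat_compE // rat_compM rat_compV !horner_rat_comp.
Qed.
End CompR.

Lemma rat_comp_poly p q : nonconstant q%:F -> p%:F \oR q%:F = (p \Po q)%:F.
Proof.
move=> ncq; rewrite rat_comp_polyl // /horner_rat /comp_poly -horner_map /=.
by rewrite -map_poly_comp.
Qed.

End Composition.

(** * Comparing two polynomials through their powers *)

Section Powers.
Variable K : numFieldType.
Implicit Types (P Q : {poly K}).

(** Agreement near 0 of two [a]-th powers descends to the bases: the cofactor of
[P - Q] in [P ^+ a - Q ^+ a] takes the value [P.[0] ^+ a.-1 *+ a] at 0. *)
Lemma dvdXn_sub_of_exp P Q m a : P.[0] = Q.[0] -> P.[0] != 0 -> (0 < a)%N ->
  'X^m %| P ^+ a - Q ^+ a -> 'X^m %| P - Q.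
Proof.
move=> PQ P0 a0; rewrite subrXX Gauss_dvdpl //.
rewrite coprimep_expl // coprimep_sym -['X]subr0 coprimep_XsubC /root.
rewrite horner_sum (eq_bigr (fun=> P.[0] ^+ a.-1)) => [|i _].
  by rewrite sumr_const card_ord mulrn_eq0 negb_or -lt0n a0 expf_neq0.
rewrite hornerM !horner_exp -PQ -exprD subnK //.
by case: a i {a0} => [[]|a i] //=; rewrite -ltnS.
Qed.

(** The analogue at infinity: if [P] and [Q] have the same leading term, of
degree [N], and the difference of their [a]-th powers has degree at most
[(a - 2) N + m], then [P - Q] has degree at most [m - N].  All the bounds are
written without truncated subtraction. *)
Lemma coef_sub_eq0_of_exp P Q N m a :
  size P = N.+1 -> size Q = N.+1 -> lead_coef P = lead_coef Q -> (0 < a)%N ->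
  (forall j, (a * N + m < j + N.*2)%N -> (P ^+ a - Q ^+ a)`_j = 0) ->
  forall j, (m < j + N)%N -> (P - Q)`_j = 0.
Proof.
move=> szP szQ lPQ a0 small j ltmj; case: (eqVneq P Q) => [->|neq].
  by rewrite subrr coef0.
apply: nth_default; rewrite leqNgt; apply/negP => ltj.
(* the cofactor: its a leading terms are equal, so they do not cancel *)
pose S := \sum_(i < a) P ^+ (a.-1 - i) * Q ^+ i.
have lead_term (i : 'I_a) : size (P ^+ (a.-1 - i) * Q ^+ i) = (a.-1 * N).+1 /\
    lead_coef (P ^+ (a.-1 - i) * Q ^+ i) = lead_coef P ^+ a.-1.
  have P0 : P != 0 by rewrite -size_poly_eq0 szP.
  have Q0 : Q != 0 by rewrite -size_poly_eq0 szQ.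
  have lti := ltn_ord i; split.
    rewrite size_mul ?expf_neq0 //.
    rewrite -[size (P ^+ _)]prednK ?size_poly_gt0 ?expf_neq0 //.
    rewrite -[size (Q ^+ _)]prednK ?size_poly_gt0 ?expf_neq0 //.
    rewrite !size_exp szP szQ /=; nia.
  rewrite lead_coefM !lead_coef_exp -lPQ -exprD; congr (_ ^+ _); lia.
have coefS : S`_(a.-1 * N) = lead_coef P ^+ a.-1 *+ a.
  rewrite coef_sum (eq_bigr (fun=> lead_coef P ^+ a.-1)) => [|i _].
    by rewrite sumr_const card_ord.
  by have [szi <-] := lead_term i; rewrite /lead_coef szi.
have S0 : S`_(a.-1 * N) != 0.
  rewrite coefS mulrn_eq0 negb_or -lt0n a0 expf_neq0 //.
  by rewrite lead_coef_eq0 -size_poly_eq0 szP.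
have szS : size S = (a.-1 * N).+1.
  apply/anti_leq/andP; split; last by rewrite ltnNge; apply: contra S0 => /leq_sizeP->.
  apply: (leq_trans (size_sum _ _ _)); apply/bigmax_leqP => i _.
  by case: (lead_term i) => ->.
have PQ0 : P - Q != 0 by rewrite subr_eq0.
have [e szPQ] : exists e, size (P - Q) = e.+1.
  by exists (size (P - Q)%R).-1; rewrite prednK // size_poly_gt0.
rewrite szPQ ltnS in ltj.
have coefM : (P ^+ a - Q ^+ a)`_(e + a.-1 * N) = lead_coef (P - Q) * lead_coef S.
  rewrite subrXX -/S -lead_coefM /lead_coef size_mul ?szS ?szPQ ?addnS //.
  by rewrite -size_poly_eq0 szS.
have aN : (a * N = N + a.-1 * N)%N by rewrite -mulSn prednK.
have /eqP := small (e + a.-1 * N)%N ltac:(lia).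
rewrite coefM mulf_eq0 !lead_coef_eq0 (negPf PQ0) /=.
by rewrite -size_poly_eq0 szS.
Qed.
End Powers.

(** * Semi-invariance under a rotation *)

(** The polynomial [C(P / 'X^k) * 'X^(k * deg C)], see [clear_denomE]. *)
Definition clear_denom (K : fieldType) (C P : {poly K}) (k : nat) : {poly K} :=
  \sum_(i < size C) C`_i *: (P ^+ i * 'X^(k * ((size C).-1 - i))).

Section Rotation.
Variable K : fieldType.
Implicit Types (C P : {poly K}).
Variable eps : K.
Notation rot P := (P \Po (eps *: 'X)).

Lemma coef_rot P i : (rot P)`_i = eps ^+ i * P`_i.
Proof.
rewrite coef_comp_poly.
have [lt|le] := ltnP i (size P); last first.
  rewrite [P`_i]nth_default // mulr0 big1 // => j _.
  rewrite exprZn coefZ coefXn.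
  by case: eqP => [Ej|_]; rewrite ?mulr0 //; have := ltn_ord j; rewrite -Ej ltnNge le.
rewrite (bigD1 (Ordinal lt)) //= big1 => [|j neq].
  by rewrite addr0 exprZn coefZ coefXn eqxx mulr1 mulrC.
rewrite exprZn coefZ coefXn; case: eqP => [Ei|_]; rewrite ?mulr0 //.
by case/eqP: neq; apply: val_inj.
Qed.

Lemma clear_denom0 C P k : (0 < k)%N -> C != 0 ->
  (clear_denom C P k).[0] = lead_coef C * P.[0] ^+ (size C).-1.
Proof.
rewrite -size_poly_gt0 /clear_denom lead_coefE => k0.
case: (size C) => // a _; rewrite big_ord_recr /= subnn muln0 expr0 mulr1.
rewrite hornerD horner_sum big1 => [|i _].
  by rewrite add0r hornerZ horner_exp.
rewrite hornerZ hornerM hornerXn expr0n muln_eq0 subn_eq0 leqNgt ltn_ord.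
by rewrite orbF [k == 0]gtn_eqF ?mulr0.
Qed.

Lemma rot_clear_denom C P k :
  rot (clear_denom C P k) =
  \sum_(i < size C) C`_i *: (eps ^+ (k * ((size C).-1 - i)) *:
      (rot P ^+ i * 'X^(k * ((size C).-1 - i)))).
Proof.
rewrite /clear_denom linear_sum /=; apply: eq_bigr => i _.
rewrite linearZ /= rmorphM /= !rmorphXn /= comp_polyX exprZn.
by rewrite -scalerAr.
Qed.

(** Invariance of [C(P / 'X^k)] under the rotation [z |-> eps z], expressed on
polynomials: the factor [eps ^+ (k * deg C)] comes from the cleared
denominator. *)
Definition semi_invariant C P k :=
  rot (clear_denom C P k) = eps ^+ (k * (size C).-1) *: clear_denom C P k.

(** The constant term of [clear_denom C P k] is nonzero and fixed by the
rotation. *)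
Lemma semi_invariant_exp1 C P k : (0 < k)%N -> C != 0 -> P.[0] != 0 ->
  semi_invariant C P k -> eps ^+ (k * (size C).-1) = 1.
Proof.
move=> k0 C0 P0 /(congr1 (fun p => p.[0])).
rewrite horner_comp !hornerZ hornerX mulr0 clear_denom0 // => /eqP.
rewrite -[X in X == _]mul1r => /eqP/mulIf -> //.
by rewrite mulf_neq0 ?lead_coef_eq0 ?expf_neq0.
Qed.

End Rotation.

Section Shape.
Variable K : numFieldType.
Implicit Types (C P : {poly K}).
Variable eps : K.
Notation rot P := (P \Po (eps *: 'X)).

(** The exponents of [P] below [2 k] are constrained by the pole at 0, those
above [2 k - deg P] by the pole at infinity. *)
Lemma semi_invariant_shape d C P k :
    d.-primitive_root eps -> (0 < k)%N -> P.[0] != 0 ->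
    (1 < size C)%N -> C`_(size C).-2 = 0 -> semi_invariant eps C P k ->
  (forall j, P`_j != 0 -> (d %| j)%N) \/
  exists u v, [/\ u != 0, v != 0 & P = u%:P + v *: 'X^(k.*2)].
Proof.
move=> prim k0 P0 szC Cb inv.
have C0 : C != 0 by rewrite -size_poly_gt0 ltnW.
have ek := semi_invariant_exp1 k0 C0 P0 inv.
have [b szCb] : exists b, size C = b.+2 by case: (size C) szC => [|[|b]] // _; exists b.
pose N := (size P).-1.
have Pn0 : P != 0 by apply: contraNneq P0 => ->; rewrite horner0.
have szP : size P = N.+1 by rewrite prednK // size_poly_gt0.
have lC0 : C`_b.+1 != 0 by rewrite -[b.+1]/(b.+2.-1) -szCb -lead_coefE lead_coef_eq0.
have e0 : eps != 0.
  apply: contra_eq_neq (prim_expr_order prim) => ->.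
  by rewrite expr0n gtn_eqF ?(prim_order_gt0 prim) // eq_sym oner_eq0.
have szrot : size (rot P) = N.+1.
  by rewrite size_comp_poly2 // size_scale // size_polyX.
(* the coefficient of index b vanishes, so that only indices i < b remain on
   the right, with factors 'X^m for which m is at least 2 k *)
have rel : C`_b.+1 *: (rot P ^+ b.+1 - P ^+ b.+1) =
    \sum_(i < b) (C`_i *: (P ^+ i - eps ^+ (k * (b.+1 - i)) *: rot P ^+ i)) *
                 'X^(k * (b.+1 - i)).
  move: inv; rewrite /semi_invariant rot_clear_denom ek scale1r /clear_denom szCb /=.
  rewrite !big_ord_recr /= !subnn !muln0 !expr0 !mulr1 !scale1r.
  rewrite szCb /= in Cb; rewrite Cb !scale0r !addr0 scalerBr => E.
  rewrite -[C`_b.+1 *: rot P ^+ _](addKr (\sum_(i < b) C`_i *: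
    (eps ^+ (k * (b.+1 - i)) *: (rot P ^+ i * 'X^(k * (b.+1 - i)))))).
  rewrite E addrA addrK addrC -sumrB; apply: eq_bigr => i _.
  by rewrite -scalerBr -scalerAl mulrBl -scalerAl.
have low j : P`_j != 0 -> (j < k.*2)%N -> (d %| j)%N.
  move=> Pj ltj; have dvdX : 'X^(k.*2) %| rot P ^+ b.+1 - P ^+ b.+1.
    rewrite -(dvdpZr _ _ lC0) rel.
    apply: (big_rec (fun p => 'X^(k.*2) %| p)) => [|i p _ dp]; first exact: dvdp0.
    rewrite dvdp_addl // dvdp_mull // dvdp_exp2l // -muln2 leq_mul2l.
    by have := ltn_ord i; lia.
  have rot0 : (rot P).[0] = P.[0] by rewrite horner_comp hornerZ hornerX mulr0.
  have /dvdpP[q Eq] : 'X^(k.*2) %| rot P - P.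
    by apply: dvdXn_sub_of_exp dvdX; rewrite ?rot0.
  have := congr1 (fun p : {poly K} => p`_j) Eq; rewrite /= coefMXn ltj coefB coef_rot.
  rewrite -[X in _ - X]mul1r -mulrBl => /eqP; rewrite mulf_eq0 (negPf Pj) orbF subr_eq0.
  by rewrite (prim_order_dvd prim).
have high j : (k < N)%N -> P`_j != 0 -> (k.*2 < j + N)%N -> eps ^+ j = eps ^+ N.
  move=> kN Pj ltj.
  have small i : (b.+1 * N + k.*2 < i + N.*2)%N -> (rot P ^+ b.+1 - P ^+ b.+1)`_i = 0.
    move=> lti; apply: (mulfI lC0); rewrite mulr0 -coefZ rel.
    rewrite coef_sum big1 // => l _; rewrite coefMXn; case: ltnP => // lei.
    apply: nth_default; apply: leq_trans (size_scale_leq _ _) _.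
    apply: leq_trans (size_polyD _ _) _; rewrite size_polyN geq_max.
    have szl (Q : {poly K}) : size Q = N.+1 -> (size (Q ^+ l)%R <= l * N + 1)%N.
      by move=> szQ; apply: leq_trans (size_poly_exp_leq _ _) _; rewrite szQ /=; lia.
    have ltl := ltn_ord l.
    have szl1 : (l * N + 1 <= i - k * (b.+1 - l))%N by nia.
    rewrite (leq_trans (szl _ szP)) //.
    by apply: leq_trans (size_scale_leq _ _) _; apply: leq_trans (szl _ szrot) _.
  (* the index (b + 1) N lies in the range where the difference vanishes *)
  have eN : (eps ^+ N) ^+ b.+1 = 1.
    have /eqP := small (b.+1 * N)%N ltac:(lia).
    have szX : size (P ^+ b.+1)%R = (b.+1 * N).+1.
      by rewrite -[LHS]prednK ?size_poly_gt0 ?expf_neq0 // size_exp mulnC.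
    have lX : (P ^+ b.+1)`_(b.+1 * N) != 0.
      rewrite -[X in _`_X]/((b.+1 * N).+1.-1) -szX -lead_coefE lead_coef_eq0.
      exact: expf_neq0.
    rewrite coefB -rmorphXn /= coef_rot -[X in _ - X]mul1r -mulrBl mulf_eq0 (negPf lX).
    by rewrite orbF subr_eq0 mulnC exprM => /eqP.
  have lrot : lead_coef (rot P) = lead_coef (eps ^+ N *: P).
    by rewrite lead_coefZ /lead_coef szrot szP coef_rot.
  have eN0 : eps ^+ N != 0 by rewrite expf_neq0.
  have := coef_sub_eq0_of_exp (m := k.*2) szrot _ lrot (ltn0Sn b) _ ltj.
  rewrite size_scale // exprZn eN scale1r => /(_ szP small)/eqP.
  by rewrite coefB coefZ coef_rot -mulrBl mulf_eq0 (negPf Pj) orbF subr_eq0 => /eqP.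
have PN0 : P`_N != 0 by rewrite -lead_coefE lead_coef_eq0.
have dvd_of j : eps ^+ j = eps ^+ N -> (d %| N)%N -> (d %| j)%N.
  by rewrite !(prim_order_dvd prim) => ->.
case: (ltngtP N k.*2) => [ltN|gtN|eqN].
- left=> j Pj; apply: low => //; apply: leq_ltn_trans ltN.
  by rewrite -ltnS -szP ltnNge; apply: contra Pj => /leq_sizeP->.
- (* the constant term of P is nonzero and now lies in the upper range *)
  have dN : (d %| N)%N.
    rewrite (prim_order_dvd prim) -(high 0%N) ?expr0 //; try lia.
    by rewrite -horner_coef0.
  by left=> j Pj; apply: dvd_of dN; apply: high => //; lia.
- case: (boolP (d %| N)%N) => [dN|ndN].
    left=> j Pj; case: (ltnP j k.*2) => [|le]; first exact: low.
    by apply: dvd_of dN; apply: high => //; lia.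
  right; exists P`_0, P`_N; split; rewrite -?horner_coef0 //.
  apply/polyP => j; rewrite coefD coefC coefZ coefXn -eqN horner_coef0.
  case: (eqVneq j 0%N) => [->|j0].
    by rewrite eq_sym gtn_eqF ?mulr0 ?addr0 //; lia.
  rewrite add0r; case: eqP => [->|neqj]; rewrite ?mulr1 // mulr0.
  apply/eqP; apply: contraNT ndN => Pj.
  have ltj : (j < N)%N.
    rewrite ltn_neqAle -ltnS -szP; apply/andP; split; first exact/eqP.
    by rewrite ltnNge; apply: contra Pj => /leq_sizeP->.
  have := high j ltac:(lia) Pj ltac:(lia).
  have := low j Pj ltac:(lia).
  by rewrite !(prim_order_dvd prim) => /eqP-> /esym/eqP.
Qed.
End Shape.

(** * Laurent polynomials and decompositions through a monomial *)

Section Laurent.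
Variable K : closedFieldType.
Implicit Types (F G H : ratfun K) (p q A C D P : {poly K}).

Lemma ratX_neq0 : (ratX : ratfun K) != 0.
Proof. by rewrite tofrac_eq0 polyX_eq0. Qed.

Lemma laurent_frac p k : laurent (p%:F / ('X^k)%:F).
Proof. by apply/laurentP; exists p, k. Qed.

Lemma laurent_nonpolyP F : laurent F -> ~ is_poly F ->
  exists P k, [/\ F = P%:F / ('X^k)%:F, P.[0] != 0 & (0 < k)%N].
Proof.
move=> /laurentP[p [k Fp]] npF.
have [j [q /implyP q0 pq]] := multiplicity_XsubC p 0.
have p0 : p != 0.
  by apply/eqP => p0; apply: npF; exists 0; rewrite Fp p0 tofrac0 mul0r.
rewrite subr0 in pq; have [ltjk|lekj] := ltnP j k.
  exists q, (k - j)%N; rewrite subn_gt0; split=> //; last by rewrite -rootE q0.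
  rewrite Fp pq -{1}(subnK (ltnW ltjk)) exprD !tofracM -mulf_div divff ?mulr1 //.
  by rewrite tofrac_eq0 expf_neq0 ?polyX_eq0.
case: npF; exists (q * 'X^(j - k)); rewrite Fp pq -{1}(subnK lekj) exprD mulrA.
by rewrite [in LHS]tofracM mulfK // tofrac_eq0 expf_neq0 ?polyX_eq0.
Qed.

Lemma pole_nonconstant P k : P.[0] != 0 -> (0 < k)%N ->
  nonconstant (P%:F / ('X^k)%:F).
Proof.
move=> P0 k0 [c /esym Ec].
have X0 : ('X^k)%:F != 0 :> ratfun K by rewrite tofrac_eq0 expf_neq0 ?polyX_eq0.
have PX : P%:F = (c%:P * 'X^k)%:F.
  by rewrite tofracM -[X in X * _]/(ratC c) Ec divfK.
move/tofrac_inj: PX P0 => ->.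
by rewrite hornerM hornerXn expr0n gtn_eqF // mulr0 eqxx.
Qed.

Lemma clear_denomE C P k :
  horner_rat C (P%:F / ('X^k)%:F) * ('X^(k * (size C).-1))%:F
  = (clear_denom C P k)%:F.
Proof.
rewrite /horner_rat horner_coef size_map_poly mulr_suml rmorph_sum.
apply: eq_bigr => i _; rewrite coef_map /= -mul_polyC !tofracM -mulrA.
congr (_ * _); have lei : (i <= (size C).-1)%N.
  by case: (size C) i => [[]|a i] //=; rewrite -ltnS.
rewrite -{1}(subnKC lei) mulnDr exprD tofracM expr_div_n -!rmorphXn /= -exprM.
by rewrite mulrA divfK // tofrac_eq0 expf_neq0 ?polyX_eq0.
Qed.

Lemma nonconstant_scaleXn (c : K) d : c != 0 -> (0 < d)%N ->
  nonconstant (c *: 'X^d)%:F.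
Proof.
by move=> c0 d0; apply/poly_nonconstantP; rewrite size_scale // size_polyXn.
Qed.

Lemma semi_invariant_of_comp eps C P k F (c : K) d :
    P.[0] != 0 -> (0 < k)%N -> c != 0 -> (0 < d)%N -> eps ^+ d = 1 ->
    C%:F \oR (P%:F / ('X^k)%:F) = F \oR (c *: 'X^d)%:F ->
  semi_invariant eps C P k.
Proof.
move=> P0 k0 c0 d0 ed.
have ncL := pole_nonconstant P0 k0.
have e0 : eps != 0.
  by apply: contra_eq_neq ed => ->; rewrite expr0n gtn_eqF // eq_sym oner_eq0.
have ncr : nonconstant (eps *: 'X)%:F by rewrite -['X]expr1; apply: nonconstant_scaleXn.
have ncD := nonconstant_scaleXn c0 d0.
move=> E; have Er : (C%:F \oR (P%:F / ('X^k)%:F)) \oR (eps *: 'X)%:F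
                  = C%:F \oR (P%:F / ('X^k)%:F).
  rewrite E rat_comp_assoc // rat_comp_poly //; congr (_ \oR _%:F).
  by rewrite linearZ /= comp_Xn_poly exprZn ed scale1r.
rewrite /semi_invariant; apply: tofrac_inj => /=.
rewrite -rat_comp_poly // -clear_denomE -rat_comp_polyl // rat_compM // Er.
rewrite rat_comp_poly // comp_Xn_poly exprZn -!mul_polyC !tofracM.
by rewrite mulrCA rat_comp_polyl // clear_denomE.
Qed.

(** A root of [D] is a pole of [L2 \o D = A \o L1], hence a pole of [L1]. *)
Lemma monomial_inner A D L1 L2 : nonconstant A%:F -> nonconstant D%:F ->
    laurent L1 -> ~ is_poly L1 -> nonconstant L1 ->
    laurent L2 -> ~ is_poly L2 ->
    A%:F \oR L1 = L2 \oR D%:F ->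
  exists c d, [/\ c != 0, (0 < d)%N & D = c *: 'X^d].
Proof.
move=> ncA ncD lL1 npL1 ncL1 lL2 npL2 E.
have [P [k [EL1 P0 k0]]] := laurent_nonpolyP lL1 npL1.
have [Q [l [EL2 Q0 l0]]] := laurent_nonpolyP lL2 npL2.
have szD : (1 < size D)%N by apply/poly_nonconstantP.
have D0 : D != 0 by rewrite -size_poly_gt0 ltnW.
have XD0 : 'X != 0 :> {poly K} by rewrite polyX_eq0.
have roots x : root D x -> x = 0.
  move=> /rootP Dx; apply/eqP; apply: contraNT Q0 => x0.
  have E2 : clear_denom A P k * D ^+ l = (Q \Po D) * 'X^(k * (size A).-1).
    apply: tofrac_inj; rewrite /= !tofracM -clear_denomE -EL1 -rat_comp_polyl // E EL2.
    rewrite rat_compM // rat_compV // !rat_comp_poly // comp_Xn_poly.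
    by rewrite mulrAC divfK // tofrac_eq0 expf_neq0.
  have := congr1 (fun p : {poly K} => p.[x]) E2.
  rewrite /= !hornerM horner_exp horner_comp Dx expr0n gtn_eqF // mulr0 => /esym/eqP.
  by rewrite mulf_eq0 hornerXn expf_eq0 (negPf x0) andbF orbF.
have [d [q /implyP/(_ D0) q0 Dq]] := multiplicity_XsubC D 0.
rewrite subr0 in Dq.
(* a root of q is a root of D, hence is 0, where q does not vanish *)
have /size_poly1P[e e0 qe] : size q == 1.
  apply: contraT => /closed_rootP[x qx].
  have x0 : x = 0 by apply: roots; rewrite Dq rootM qx.
  by rewrite x0 (negPf q0) in qx.
exists e, d; split=> //; last by rewrite Dq qe mul_polyC.
by rewrite lt0n; apply: contraTneq szD => d0; rewrite Dq qe d0 mulr1 size_polyC e0.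
Qed.

(** A subalgebra of polynomials in which every degree is a multiple of [n] is
generated by any of its elements of degree [n]; here the subalgebra consists of
the [C] such that [C \o L] factors through [D]. *)
Lemma exists_factor_through (L : ratfun K) D (T : {poly K}) G n :
    nonconstant L -> nonconstant D%:F -> (0 < n)%N -> size T = n.+1 ->
    T%:F \oR L = G \oR D%:F ->
    (forall C F, C != 0 -> C%:F \oR L = F \oR D%:F -> (n %| (size C).-1)%N) ->
  forall C F, C%:F \oR L = F \oR D%:F -> exists Q, C = Q \Po T.
Proof.
move=> ncL ncD n0 szT ET deg C; have [m] := ubnP (size C).
elim: m C => // m IHm C; rewrite ltnS => leCm F EC.
have [|lt1C] := leqP (size C) 1.
  by move/size1_polyC => ->; exists (C`_0)%:P; rewrite comp_polyC.
have C0 : C != 0 by rewrite -size_poly_gt0 ltnW.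
have /dvdnP[q Eq] := deg C F C0 EC.
pose u := lead_coef C / lead_coef T ^+ q.
have T0 : T != 0 by rewrite -size_poly_eq0 szT.
have lT0 : lead_coef T != 0 by rewrite lead_coef_eq0.
have u0 : u != 0 by rewrite mulf_neq0 ?invr_eq0 ?expf_neq0 // lead_coef_eq0.
have szu : size (u *: T ^+ q) = size C.
  rewrite size_scale // -[LHS]prednK ?size_poly_gt0 ?expf_neq0 // size_exp szT /=.
  by rewrite mulnC -Eq prednK // ltnW.
have lu : lead_coef (u *: T ^+ q) = lead_coef C.
  by rewrite lead_coefZ lead_coef_exp divfK // expf_neq0.
have ltC : (size (C - u *: T ^+ q)%R < size C)%N.
  rewrite -[X in (_ < X)%N]prednK ?(ltnW lt1C) // ltnS; apply/leq_sizeP => j.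
  rewrite leq_eqVlt coefB => /orP[/eqP<-|ltj].
    by rewrite -lead_coefE -szu -lead_coefE lu subrr.
  rewrite !nth_default ?subrr // ?szu; by case: (size C) ltj.
have [||Q EQ] := IHm (C - u *: T ^+ q) _ (F - ratC u * G ^+ q).
- exact: leq_trans ltC leCm.
- rewrite rat_compB // rat_compM // rat_compXn // rat_compC // -ET -EC.
  rewrite tofracB rat_compB // -mul_polyC tofracM rat_compM //.
  by rewrite [_%:P%:F \oR L]rat_compC // rmorphXn rat_compXn.
exists (Q + u *: 'X^q); rewrite comp_polyD -EQ comp_polyZ comp_Xn_poly.
by rewrite subrK.
Qed.

End Laurent.

Section Center.
Variable K : numClosedFieldType.

Lemma exists_prim_root n : (0 < n)%N -> exists z : K, n.-primitive_root z.
Proof.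
move=> n0; have [r Er] := closed_field_poly_normal ('X^n - 1 : {poly K}).
move: Er; rewrite (monicP (monicXnsubC _ n0)) scale1r => Er.
have sz : size r = n.
  by have := size_XnsubC (1 : K) n0; rewrite Er size_prod_XsubC => -[].
have : has n.-primitive_root r; last by case/hasP => z _; exists z.
apply: cyclic.has_prim_root => //; last by rewrite sz.
  by apply/allP => z; rewrite /root_of_unity Er root_prod_XsubC.
rewrite -separable_prod_XsubC -Er separable_Xn_sub_1 //.
by rewrite pnatr_eq0 -lt0n.
Qed.

(** The translation by the mean [c] of the roots kills the subleading
coefficient. *)
Lemma exists_center (A : {poly K}) : (1 < size A)%N ->
  exists c : K, (A \Po ('X + c%:P))`_(size A).-2 = 0.
Proof.
move=> szA; have [s Es] := closed_field_poly_normal A.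
have A0 : A != 0 by rewrite -size_poly_gt0 ltnW.
have sz : size A = (size s).+1.
  by rewrite Es size_scale ?lead_coef_eq0 // size_prod_XsubC.
have s0 : (size s)%:R != 0 :> K by rewrite pnatr_eq0; case: (size s) sz szA => // ->.
exists ((\sum_(r <- s) r) / (size s)%:R); set c := _ / _.
rewrite Es linearZ /= rmorph_prod /= coefZ.
rewrite (eq_bigr (fun r => 'X - (r - c)%:P)) => [|r _]; last first.
  by rewrite rmorphB /= comp_polyX comp_polyC polyCB opprB addrA addrAC.
rewrite -(big_map (fun r => r - c) predT (fun r => 'X - r%:P)) -Es sz /=.
rewrite -(size_map (fun r => r - c)) coefPn_prod_XsubC; last first.
  by rewrite size_map; case: (size s) sz szA => // ->.
rewrite big_map sumrB big_const_seq count_predT iter_addr_0 -[c *+ _]mulr_natr.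
by rewrite divfK // subrr oppr0 mulr0.
Qed.
End Center.

(** * Chebyshev polynomials *)

Section Chebyshev.
Variable K : numClosedFieldType.

(** The pair of the [n]-th and [(n + 1)]-st Chebyshev polynomials. *)
Fixpoint cheb_pair n : {poly K} * {poly K} :=
  if n is n'.+1 then
    let: (p, q) := cheb_pair n' in (q, 2%:R *: ('X * q) - p)
  else (1, 'X).

(** The [n]-th Chebyshev polynomial of the first kind. *)
Definition chebT n := (cheb_pair n).1.

Lemma chebT0 : chebT 0 = 1. Proof. by []. Qed.
Lemma chebT1 : chebT 1 = 'X. Proof. by []. Qed.
Lemma chebTS n : chebT n.+2 = 2%:R *: ('X * chebT n.+1) - chebT n.
Proof. by rewrite /chebT /=; case: (cheb_pair n). Qed.

Lemma cheb_ind (P : nat -> Prop) :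
  P 0%N -> P 1%N -> (forall n, P n -> P n.+1 -> P n.+2) -> forall n, P n.
Proof.
move=> P0 P1 PS n; suff [] : P n /\ P n.+1 by [].
by elim: n => // n [Pn PSn]; split=> //; apply: PS.
Qed.

Lemma size_chebT n : size (chebT n) = n.+1.
Proof.
elim/cheb_ind: n => [||n szn szSn]; rewrite ?chebT0 ?chebT1 ?size_poly1 ?size_polyX //.
have sz2 : size (2%:R *: ('X * chebT n.+1)) = n.+3.
  rewrite size_scale ?pnatr_eq0 // mulrC size_mulX ?szSn //.
  by rewrite -size_poly_eq0 szSn.
by rewrite chebTS size_polyDl ?sz2 // size_polyN szn.
Qed.

Lemma ratD_comp m n : (0 < n)%N -> @ratD K m \oR ratX ^+ n = ratD (n * m).
Proof.
move=> n0; have ncn : nonconstant (ratX ^+ n : ratfun K).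
  by rewrite /ratX -rmorphXn; apply/poly_nonconstantP; rewrite size_polyXn.
rewrite /ratD rat_compM // rat_compD // !rat_compV // !rat_compXn //.
rewrite rat_comp_ratX // -!exprM; congr (_^-1 * _).
have -> : 2%:R = ratC 2%:R :> ratfun K by rewrite rmorph_nat.
by rewrite rat_compC.
Qed.

(** With [c z = (z + z^-1) / 2], this is
[2 (c x) (c (x y)) - c y = c (x^2 y)]: the recurrence of the Chebyshev
polynomials, satisfied by the functions [ratD]. *)
Lemma cosh_addition (F : fieldType) (x y : F) : 2%:R != 0 :> F -> x != 0 -> y != 0 ->
  2%:R * (2%:R^-1 * (x + x^-1) * (2%:R^-1 * (x * y + (x * y)^-1)))
   - 2%:R^-1 * (y + y^-1) = 2%:R^-1 * (x * (x * y) + (x * (x * y))^-1).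
Proof. by move=> two0 x0 y0; field; rewrite two0 x0 y0. Qed.

Lemma ratfun_two_neq0 : 2%:R != 0 :> ratfun K.
Proof. by rewrite -(rmorph_nat (@ratC K)) fmorph_eq0 pnatr_eq0. Qed.

Lemma horner_rat_chebT m n : horner_rat (chebT n) (@ratD K m) = ratD (n * m).
Proof.
have X0 := ratX_neq0 K.
elim/cheb_ind: n => [||n En ESn].
- rewrite chebT0 /horner_rat rmorph1 hornerE mul0n /ratD !expr0 invr1.
  by rewrite -[X in _ * X]mulr2n mulVf ?ratfun_two_neq0.
- by rewrite chebT1 /horner_rat map_polyX hornerX mul1n.
rewrite chebTS -mul_polyC /horner_rat rmorphB !rmorphM /= hornerD hornerN !hornerM.
rewrite map_polyX hornerX map_polyC hornerC -!/(horner_rat _ _) En ESn.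
have -> : Defs_ratC__canonical__Algebra_Additive K 2%:R = 2%:R.
  exact: rmorph_nat (@ratC K) 2.
rewrite /ratD !mulSn !exprD; apply: cosh_addition.
- exact: ratfun_two_neq0.
- exact: expf_neq0 _ X0.
- exact: expf_neq0 _ X0.
Qed.
End Chebyshev.

Lemma chebyshev_chebT (R : realType) n : chebyshev n (chebT R[i] n).
Proof.
move=> phi; elim/cheb_ind: n => [||n En ESn].
- by rewrite chebT0 hornerC mul0r cos0.
- by rewrite chebT1 hornerX mul1r.
rewrite chebTS hornerD hornerN hornerZ hornerM hornerX En ESn.
have -> : cos (n.+2%:R * phi) =
    2%:R * (cos phi * cos (n.+1%:R * phi)) - cos (n%:R * phi).
  have -> : n.+2%:R * phi = n.+1%:R * phi + phi.
    by rewrite -[n.+2]addn1 natrD mulrDl mul1r.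
  have -> : n%:R * phi = n.+1%:R * phi - phi.
    by rewrite -[n.+1]addn1 natrD mulrDl mul1r addrK.
  by rewrite cosB cosD; ring.
by rewrite rmorphB !rmorphM rmorph_nat.
Qed.

(** * Assembling the decomposition *)

Section Assembly.
Variable K : numClosedFieldType.
Implicit Types (F G : ratfun K) (A C D P Q : {poly K}).

Lemma laurent_affine (a c : K) F : laurent F -> laurent (ratC a * F + ratC c).
Proof.
move=> /laurentP[p [k ->]]; apply/laurentP; exists (a *: p + c *: 'X^k), k.
have X0 : ('X^k)%:F != 0 :> ratfun K by rewrite tofrac_eq0 expf_neq0 ?polyX_eq0.
by rewrite -!mul_polyC tofracD !tofracM mulrDl mulfK // mulrA.
Qed.

Lemma laurent_scale (e : K) F : e != 0 -> laurent F -> laurent (F \oR (e *: 'X)%:F).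
Proof.
move=> e0 /laurentP[p [k ->]]; apply/laurentP.
have nce : nonconstant (e *: 'X)%:F by rewrite -['X]expr1; apply: nonconstant_scaleXn.
exists (e ^- k *: (p \Po (e *: 'X))), k.
have X0 : ('X^k)%:F != 0 :> ratfun K by rewrite tofrac_eq0 expf_neq0 ?polyX_eq0.
rewrite rat_compM // rat_compV // !rat_comp_poly // comp_Xn_poly exprZn.
have eV : (e ^- k)%:P%:F = (e ^+ k)%:P%:F^-1 :> ratfun K by exact: (fmorphV (@ratC K)).
by rewrite -!mul_polyC !tofracM eV invfM mulrA [in RHS](mulrC _^-1).
Qed.

Lemma equiv_decomp_affine (a b : K) (F2 F1 G2 G1 : ratfun K) : a != 0 ->
  F2 = G2 \oR (a^-1 *: ('X - b%:P))%:F -> F1 = (a *: 'X + b%:P)%:F \oR G1 ->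
  equiv_decomp F2 F1 G2 G1.
Proof.
move=> a0 E2 E1.
have a'0 : a^-1 != 0 by rewrite invr_eq0.
have sz1 : size (a^-1 *: ('X - b%:P)) = 2 by rewrite size_scale // size_XsubC.
have sz2 : size (a *: 'X + b%:P) = 2.
  by rewrite size_polyDl size_scale // size_polyX // size_polyC; case: eqP.
have nc1 : nonconstant (a^-1 *: ('X - b%:P))%:F by apply/poly_nonconstantP; rewrite sz1.
have nc2 : nonconstant (a *: 'X + b%:P)%:F by apply/poly_nonconstantP; rewrite sz2.
exists (a^-1 *: ('X - b%:P))%:F, (a *: 'X + b%:P)%:F; split=> //.
- exists (a^-1 *: ('X - b%:P)), 1; split; rewrite ?oner_neq0 ?coprimep1 //.
    by rewrite tofrac1 divr1.
  by rewrite sz1 size_poly1.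
- rewrite rat_comp_poly // comp_polyZ comp_polyB comp_polyX comp_polyC addrK.
  by rewrite scalerA mulVf // scale1r.
- rewrite rat_comp_poly // comp_polyD comp_polyZ comp_polyX comp_polyC scalerA.
  by rewrite divff // scale1r subrK.
Qed.

(** If [C \o L1] factors through ['X^d], the lowest term at 0 forces
[eps ^+ (k * deg C) = 1] for a primitive [d]-th root of unity [eps]. *)
Lemma degree_dvd (L1 : ratfun K) P k (c e : K) d C F :
    L1 = P%:F / ('X^k)%:F + ratC c -> P.[0] != 0 -> (0 < k)%N ->
    e != 0 -> (0 < d)%N -> C != 0 -> C%:F \oR L1 = F \oR (e *: 'X^d)%:F ->
  (d %/ gcdn k d %| (size C).-1)%N.
Proof.
move=> EL1 P0 k0 e0 d0 C0 E.
have ncL := pole_nonconstant P0 k0.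
have szXc : size ('X + c%:P) = 2 by rewrite -[c]opprK polyCN size_XsubC.
have ncXc : nonconstant ('X + c%:P)%:F by apply/poly_nonconstantP; rewrite szXc.
have [eps prim] := exists_prim_root K d0.
have E' : (C \Po ('X + c%:P))%:F \oR (P%:F / ('X^k)%:F) = F \oR (e *: 'X^d)%:F.
  rewrite -E -rat_comp_poly // rat_comp_assoc // EL1; congr (_ \oR _).
  by rewrite tofracD rat_compD // rat_comp_ratX // [_ \oR _]rat_compC.
have inv := semi_invariant_of_comp P0 k0 e0 d0 (prim_expr_order prim) E'.
have Cc0 : C \Po ('X + c%:P) != 0.
  by rewrite -size_poly_eq0 size_comp_poly2 // size_poly_eq0.
have /eqP := semi_invariant_exp1 k0 Cc0 P0 inv.
rewrite size_comp_poly2 // -(prim_order_dvd prim) => dvd.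
have g0 : (0 < gcdn k d)%N by rewrite gcdn_gt0 k0.
have cop : coprime (d %/ gcdn k d) (k %/ gcdn k d).
  rewrite /coprime gcdnC -(eqn_pmul2r g0) mul1n muln_gcdl.
  by rewrite !divnK ?dvdn_gcdl ?dvdn_gcdr.
rewrite -(Gauss_dvdr _ cop) -(dvdn_pmul2r g0) divnK ?dvdn_gcdr //.
by rewrite mulnAC divnK // dvdn_gcdl.
Qed.

(** From a pair [E \o G = G' \o 'X^n] with [E] of the right degree, and an
expression of [L1] as [(a G + c) \o (b 'X^g)], all the required factors
follow: the left factor is [E \o ((z - c) / a)], and the cofactor of [A] is
provided by [exists_factor_through]. *)
Lemma assemble A D (L1 L2 : ratfun K) P k (c e : K) d
    (E : {poly K}) (G G' : ratfun K) (a b : K) :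
    nonconstant A%:F -> D = e *: 'X^d -> e != 0 -> (0 < d)%N ->
    A%:F \oR L1 = L2 \oR D%:F ->
    L1 = P%:F / ('X^k)%:F + ratC c -> P.[0] != 0 -> (0 < k)%N ->
    a != 0 -> b != 0 -> laurent G -> laurent G' ->
    let g := gcdn k d in let n := (d %/ g)%N in
    size E = n.+1 -> E%:F \oR G = G' \oR ratX ^+ n ->
    P%:F / ('X^k)%:F = ratC a * (G \oR (b *: 'X^g)%:F) ->
  exists (Q At Dt W : {poly K}) (Lt1 Lt2 : ratfun K),
    [/\ [/\ nonconstant Q%:F, nonconstant At%:F, nonconstant Dt%:F
          & nonconstant W%:F],
        [/\ nonconstant Lt1, nonconstant Lt2, laurent Lt1 & laurent Lt2],
        [/\ A = Q \Po At, L2 = Q%:F \oR Lt2, L1 = Lt1 \oR W%:F, D = Dt \Po W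
          & At%:F \oR Lt1 = Lt2 \oR Dt%:F]
      & equiv_decomp At%:F Lt1 E%:F G /\ equiv_decomp Lt2 Dt%:F G' (ratX ^+ n)].
Proof.
move=> ncA ED e0 d0 EA EL1 P0 k0 a0 b0 lG lG' g n szE EE EP.
have g0 : (0 < g)%N by rewrite gcdn_gt0 k0.
have dn : (n * g)%N = d by rewrite divnK // dvdn_gcdr.
have n0 : (0 < n)%N by move: d0; rewrite -dn muln_gt0 => /andP[].
(* f is determined by D = (f 'X^n) \o (b 'X^g) *)
pose f := e / b ^+ n.
have f0 : f != 0 by rewrite mulf_neq0 ?invr_eq0 ?expf_neq0.
have f'0 : f^-1 != 0 by rewrite invr_eq0.
pose W := b *: 'X^g; pose Dt := f *: 'X^n.
pose mu := a^-1 *: ('X - c%:P).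
pose At := E \Po mu; pose Lt1 := ratC a * G + ratC c.
pose Lt2 := G' \oR (f^-1 *: 'X)%:F.
have szmu : size mu = 2 by rewrite size_scale ?invr_eq0 // size_XsubC.
have ncmu : nonconstant mu%:F by apply/poly_nonconstantP; rewrite szmu.
have ncW : nonconstant W%:F by apply: nonconstant_scaleXn.
have ncDt : nonconstant Dt%:F by apply: nonconstant_scaleXn.
have ncf : nonconstant (f^-1 *: 'X)%:F.
  by rewrite -['X]expr1; apply: nonconstant_scaleXn.
have ncD : nonconstant D%:F by rewrite ED; apply: nonconstant_scaleXn.
have EWL1 : L1 = Lt1 \oR W%:F.
  by rewrite /Lt1 rat_compD // rat_compM // !rat_compC // EL1 EP.
have ncG : nonconstant G.
  move=> [u Eu]; apply: (pole_nonconstant P0 k0); exists (a * u).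
  by rewrite EP Eu rat_compC // rmorphM.
have ncE : nonconstant E%:F by apply/poly_nonconstantP; rewrite szE.
have ncXn : nonconstant (ratX ^+ n : ratfun K).
  by rewrite /ratX -rmorphXn; apply/poly_nonconstantP; rewrite size_polyXn.
have ncG' : nonconstant G'.
  by apply: (nonconstant_compl ncXn); rewrite -EE; apply: nonconstant_comp.
have ncLt2 : nonconstant Lt2 by apply: nonconstant_comp.
have ncL1 : nonconstant L1.
  move=> [u Eu]; apply: (pole_nonconstant P0 k0); exists (u - c).
  by rewrite -(addrK (ratC c) (_ / _)) -EL1 Eu [RHS]rmorphB.
have ncLt1 : nonconstant Lt1 by apply: (nonconstant_compl ncW); rewrite -EWL1.
have EDW : D = Dt \Po W.
  rewrite ED /Dt comp_polyZ comp_Xn_poly exprZn -exprM mulnC dn scalerA.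
  by rewrite divfK ?expf_neq0.
have mid : At%:F \oR Lt1 = Lt2 \oR Dt%:F.
  rewrite /At -rat_comp_poly // rat_comp_assoc // rat_comp_assoc //.
  have -> : mu%:F \oR Lt1 = G.
    rewrite /mu -mul_polyC tofracM rat_compM // [_ \oR _]rat_compC //.
    rewrite tofracB rat_compB // rat_comp_ratX // [c%:P%:F \oR _]rat_compC //.
    by rewrite /Lt1 addrK mulrA -rmorphM mulVf // rmorph1 mul1r.
  rewrite EE; congr (_ \oR _); rewrite rat_comp_poly // comp_polyZ comp_polyX.
  by rewrite scalerA mulVf // scale1r /ratX -rmorphXn.
have big : At%:F \oR L1 = Lt2 \oR D%:F.
  by rewrite EWL1 EDW -rat_comp_assoc // mid rat_comp_assoc // rat_comp_poly.
have szAt : size At = n.+1 by rewrite size_comp_poly2.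
have ncAt : nonconstant At%:F by apply/poly_nonconstantP; rewrite szAt.
have deg C F : C != 0 -> C%:F \oR L1 = F \oR D%:F -> (n %| (size C).-1)%N.
  by rewrite ED; exact: degree_dvd EL1 P0 k0 e0 d0.
have [Q EQ] := exists_factor_through ncL1 ncD n0 szAt big deg EA.
have EQL2 : L2 = Q%:F \oR Lt2.
  apply: (rat_comp_inj ncD) => /=.
  by rewrite -EA rat_comp_assoc // -big -rat_comp_assoc // rat_comp_poly // -EQ.
have ncQ : nonconstant Q%:F.
  by apply: (nonconstant_compl ncAt); rewrite rat_comp_poly // -EQ.
exists Q, At, Dt, W, Lt1, Lt2; split=> //; first split=> //.
- exact: laurent_affine.
- exact: laurent_scale.
split.
- apply: (equiv_decomp_affine a0); first by rewrite rat_comp_poly.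
  rewrite tofracD rat_compD // [_%:P%:F \oR _]rat_compC // -mul_polyC tofracM.
  by rewrite rat_compM // rat_comp_ratX // [_%:P%:F \oR _]rat_compC.
apply: (@equiv_decomp_affine f 0) => //; first by rewrite subr0.
have EXn : (ratX ^+ n : ratfun K) = ('X^n)%:F by rewrite rmorphXn.
rewrite addr0 EXn rat_comp_poly ?comp_polyZ ?comp_polyX //.
by rewrite -EXn.
Qed.

End Assembly.

(** * The power case and the Chebyshev case *)

Lemma binomial_identity (F : fieldType) (U B x : F) :
  2%:R != 0 :> F -> B != 0 -> x != 0 ->
  (U + U * B * B * (x * x)) / x = 2%:R * U * B * (2%:R^-1 * (B * x + (B * x)^-1)).
Proof. by move=> two0 B0 x0; field; rewrite two0 B0 x0. Qed.

Section Cases.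
Variable K : numClosedFieldType.
Implicit Types (P S : {poly K}).

Lemma ratXnE n : (ratX ^+ n : ratfun K) = ('X^n)%:F.
Proof. by rewrite rmorphXn. Qed.

Lemma nonconstant_ratXn n : (0 < n)%N -> nonconstant (ratX ^+ n : ratfun K).
Proof. by move=> n0; rewrite ratXnE; apply/poly_nonconstantP; rewrite size_polyXn. Qed.

Lemma poly_in_Xn P d : (0 < d)%N -> (forall j, P`_j != 0 -> (d %| j)%N) ->
  exists S, P = S \Po 'X^d.
Proof.
move=> d0 dvdP; exists (\poly_(i < size P) P`_(i * d)); apply/polyP => j.
rewrite coef_comp_poly_Xn //; case: ifPn => [/dvdnP[q ->]|ndvd].
  rewrite mulnK // coef_poly; case: ltnP => // leq.
  by rewrite nth_default // (leq_trans leq) // leq_pmulr.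
by apply/eqP; apply: contraNT ndvd; apply: dvdP.
Qed.

Lemma laurent_X_mul_exp r n (L : ratfun K) : laurent L -> laurent (ratX ^+ r * L ^+ n).
Proof.
move=> /laurentP[p [k ->]]; apply/laurentP; exists ('X^r * p ^+ n), (k * n)%N.
by rewrite expr_div_n -!rmorphXn /= -exprM tofracM mulrA.
Qed.

Lemma laurent_X_mul_comp r n (L : ratfun K) : (0 < n)%N -> laurent L ->
  laurent (ratX ^+ r * (L \oR ratX ^+ n)).
Proof.
move=> n0 /laurentP[p [k ->]]; apply/laurentP.
have ncn := nonconstant_ratXn n0; rewrite ratXnE in ncn.
exists ('X^r * (p \Po 'X^n)), (n * k)%N.
rewrite (ratXnE n) rat_compM // rat_compV // !rat_comp_poly // comp_Xn_poly -exprM.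
by rewrite ratXnE tofracM mulrA.
Qed.

Lemma laurent_ratD m : laurent (@ratD K m).
Proof.
apply/laurentP; exists (2%:R^-1 *: ('X^m * 'X^m + 1)), m.
have X0 : ('X^m)%:F != 0 :> ratfun K by rewrite tofrac_eq0 expf_neq0 ?polyX_eq0.
have two : (2%:R^-1)%:P%:F = 2%:R^-1 :> ratfun K.
  by rewrite -(rmorph_nat (@ratC K)); exact: (fmorphV (@ratC K)).
rewrite -mul_polyC tofracM two tofracD tofracM tofrac1 /ratD ratXnE.
by rewrite -mulrA mulrDl mulfK // mul1r.
Qed.

Lemma power_case P k d : (0 < k)%N -> (0 < d)%N -> P.[0] != 0 ->
    (forall j, P`_j != 0 -> (d %| j)%N) ->
    let g := gcdn k d in let n := (d %/ g)%N in
  exists (L : ratfun K) r, [/\ nonconstant L, laurent L, coprime r n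
    & P%:F / ('X^k)%:F = (ratX ^+ r * (L \oR ratX ^+ n)) \oR ('X^g)%:F].
Proof.
move=> k0 d0 P0 /(poly_in_Xn d0)[S ES] g n.
have g0 : (0 < g)%N by rewrite gcdn_gt0 k0.
have dn : (n * g)%N = d by rewrite divnK // dvdn_gcdr.
have kg : (k %/ g * g)%N = k by rewrite divnK // dvdn_gcdl.
have n0 : (0 < n)%N by move: d0; rewrite -dn muln_gt0 => /andP[].
have k'0 : (0 < k %/ g)%N by move: k0; rewrite -{1}kg muln_gt0 => /andP[].
have S0 : S.[0] != 0 by move: P0; rewrite ES horner_comp hornerXn expr0n gtn_eqF.
have ncn := nonconstant_ratXn n0.
have ncg := nonconstant_ratXn g0.
have ncgn : nonconstant ((ratX ^+ n : ratfun K) \oR ratX ^+ g).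
  by apply: nonconstant_comp.
(* n - 1 is -1 modulo n, so r is a nonnegative representative of -k/g *)
exists (S%:F / ('X^(k %/ g))%:F), (n.-1 * (k %/ g))%N; split.
- exact: pole_nonconstant.
- exact: laurent_frac.
- rewrite coprimeMl coprimePn // /coprime.
  by rewrite -(eqn_pmul2r g0) mul1n muln_gcdl kg dn /g eqxx.
rewrite -(ratXnE g) rat_compM // rat_comp_assoc // rat_compXn // rat_comp_ratX //.
have -> : (ratX ^+ n : ratfun K) \oR ratX ^+ g = ('X^d)%:F.
  by rewrite rat_compXn // rat_comp_ratX // -exprM mulnC dn ratXnE.
have ncd : nonconstant ('X^d : {poly K})%:F.
  by apply/poly_nonconstantP; rewrite size_polyXn.
rewrite rat_compM // rat_compV // !rat_comp_poly // comp_Xn_poly -ES -!exprM.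
have -> : ('X^(d * (k %/ g)))%:F =
    ratX ^+ (g * (n.-1 * (k %/ g))) * ('X^k)%:F :> ratfun K.
  rewrite -!ratXnE -exprD; congr (_ ^+ _).
  by rewrite -{3}kg -dn -{1}(prednK n0); nia.
have Xe0 : ratX ^+ (g * (n.-1 * (k %/ g))) != 0 :> ratfun K.
  by rewrite expf_neq0 ?ratX_neq0.
by rewrite invfM mulrCA [X in _ = _ * X]mulrA divff // mul1r.
Qed.

Lemma binomial_case k d (u v : K) : (0 < k)%N -> (0 < d)%N -> u != 0 -> v != 0 ->
    let g := gcdn k d in
  exists a b, [/\ a != 0, b != 0
    & (u%:P + v *: 'X^(k.*2))%:F / ('X^k)%:F
      = ratC a * (ratD (k %/ g) \oR (b *: 'X^g)%:F)].
Proof.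
move=> k0 d0 u0 v0 g.
have g0 : (0 < g)%N by rewrite gcdn_gt0 k0.
have kg : (k %/ g * g)%N = k by rewrite divnK // dvdn_gcdl.
have k'0 : (0 < k %/ g)%N by move: k0; rewrite -{1}kg muln_gt0 => /andP[].
pose m := (k %/ g)%N; pose b := m.*2.-root (v / u).
have Eb : b ^+ m * b ^+ m = v / u by rewrite -exprD addnn rootCK // double_gt0.
have b0 : b != 0.
  rewrite rootC_eq0 ?double_gt0 // mulf_neq0 ?invr_eq0 //.
have bm0 : b ^+ m != 0 by rewrite expf_neq0.
(* solves a b^m / 2 = v and a b^-m / 2 = u *)
exists (2%:R * u * b ^+ m), b; split=> //; first by rewrite !mulf_neq0 ?pnatr_eq0.
have ncW := nonconstant_scaleXn b0 g0.
rewrite /ratD rat_compM // rat_compD // !rat_compV // !rat_compXn // rat_comp_ratX //.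
have E2 : 2%:R = ratC 2%:R :> ratfun K by rewrite rmorph_nat.
have E2' : 2%:R \oR (b *: 'X^g)%:F = 2%:R :> ratfun K by rewrite E2 rat_compC.
rewrite E2' -rmorphXn /= exprZn -exprM mulnC kg.
have Ev : v%:P%:F = ratC u * ratC (b ^+ m) * ratC (b ^+ m) :> ratfun K.
  by rewrite -mulrA -!rmorphM Eb mulrC divfK.
have Ea : ratC (2%:R * u * b ^+ m) = 2%:R * ratC u * ratC (b ^+ m) :> ratfun K.
  by rewrite !rmorphM rmorph_nat.
rewrite -!mul_polyC tofracD !tofracM -addnn exprD tofracM Ev Ea.
apply: binomial_identity.
- exact: ratfun_two_neq0.
- by rewrite fmorph_eq0.
- by rewrite tofrac_eq0 expf_neq0 ?polyX_eq0.
Qed.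
End Cases.

(** * The classification *)

(** The statement holds over every algebraically closed field with a norm, with
the recursively defined Chebyshev polynomials. *)
Lemma laurent_composition (K : numClosedFieldType) (A D : {poly K})
    (L1 L2 : ratfun K) :
    nonconstant A%:F -> nonconstant D%:F -> nonconstant L1 ->
    laurent L1 -> laurent L2 -> ~ is_poly L1 -> ~ is_poly L2 ->
    A%:F \oR L1 = L2 \oR D%:F ->
  exists (Q At Dt W : {poly K}) (Lt1 Lt2 : ratfun K),
    [/\ [/\ nonconstant Q%:F, nonconstant At%:F, nonconstant Dt%:F
          & nonconstant W%:F],
        [/\ nonconstant Lt1, nonconstant Lt2, laurent Lt1 & laurent Lt2],
        [/\ A = Q \Po At, L2 = Q%:F \oR Lt2, L1 = Lt1 \oR W%:F, D = Dt \Po W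
          & At%:F \oR Lt1 = Lt2 \oR Dt%:F]
      & (exists (L : ratfun K) (r n : nat),
           [/\ nonconstant L, laurent L, (1 <= n)%N, coprime r n
             & equiv_decomp At%:F Lt1 (ratX ^+ n) (ratX ^+ r * (L \oR ratX ^+ n))
               /\ equiv_decomp Lt2 Dt%:F (ratX ^+ r * L ^+ n) (ratX ^+ n)])
        \/
        (exists n m : nat,
           [/\ (1 <= n)%N, (1 <= m)%N, coprime m n
             & equiv_decomp At%:F Lt1 (chebT K n)%:F (ratD m)
               /\ equiv_decomp Lt2 Dt%:F (ratD m) (ratX ^+ n)])].
Proof.
move=> ncA ncD ncL1 laurL1 laurL2 npL1 npL2 eqAL.
have [e [d [e0 d0 ED]]] := monomial_inner ncA ncD laurL1 npL1 ncL1 laurL2 npL2 eqAL.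
have szA : (1 < size A)%N by apply/poly_nonconstantP.
have [c Bc] := exists_center szA; pose B := A \Po ('X + c%:P).
have szXc : size ('X + c%:P) = 2 by rewrite -[c]opprK polyCN size_XsubC.
have ncXc : nonconstant ('X + c%:P)%:F by apply/poly_nonconstantP; rewrite szXc.
have szB : size B = size A by rewrite size_comp_poly2.
have [P [k [EL1 P0 k0]]] : exists P k,
    [/\ L1 - ratC c = P%:F / ('X^k)%:F, P.[0] != 0 & (0 < k)%N].
  apply: laurent_nonpolyP.
    by have := @laurent_affine _ 1 (- c) _ laurL1; rewrite rmorph1 mul1r rmorphN.
  move=> [p Ep]; apply: npL1; exists (p + c%:P).
  by rewrite tofracD -Ep subrK.
have {}EL1 : L1 = P%:F / ('X^k)%:F + ratC c by rewrite -EL1 subrK.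
have ncPX := pole_nonconstant P0 k0.
have EB : B%:F \oR (P%:F / ('X^k)%:F) = L2 \oR (e *: 'X^d)%:F.
  rewrite -ED -eqAL /B -rat_comp_poly // rat_comp_assoc // EL1; congr (_ \oR _).
  by rewrite tofracD rat_compD // rat_comp_ratX // [_%:P%:F \oR _]rat_compC.
have [eps prim] := exists_prim_root K d0.
have inv := semi_invariant_of_comp P0 k0 e0 d0 (prim_expr_order prim) EB.
have szB1 : (1 < size B)%N by rewrite szB.
have Bc0 : B`_(size B).-2 = 0 by rewrite szB.
pose g := gcdn k d; pose n := (d %/ g)%N.
have g0 : (0 < g)%N by rewrite gcdn_gt0 k0.
have dn : (n * g)%N = d by rewrite divnK // dvdn_gcdr.
have n0 : (0 < n)%N by move: d0; rewrite -dn muln_gt0 => /andP[].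
have ncn := @nonconstant_ratXn K n n0.
have [dvdP|[u [v [u0 v0 EP]]]] := semi_invariant_shape prim k0 P0 szB1 Bc0 inv.
  have [L [r [ncL lL cop EPk]]] := power_case k0 d0 P0 dvdP.
  rewrite -/g -/n in cop EPk.
  have ncG : nonconstant (ratX ^+ r * (L \oR ratX ^+ n)).
    move=> [u Eu]; apply: ncPX; exists u; rewrite EPk Eu rat_compC //.
    by rewrite -ratXnE; apply: nonconstant_ratXn.
  have EE : ('X^n)%:F \oR (ratX ^+ r * (L \oR ratX ^+ n))
          = (ratX ^+ r * L ^+ n) \oR ratX ^+ n.
    rewrite -ratXnE rat_compXn // rat_comp_ratX // rat_compM // !rat_compXn //.
    by rewrite rat_comp_ratX // exprMn -!exprM mulnC.
  have EP1 : P%:F / ('X^k)%:F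
           = ratC 1 * ((ratX ^+ r * (L \oR ratX ^+ n)) \oR (1 *: 'X^g)%:F).
    by rewrite EPk rmorph1 mul1r scale1r.
  have [Q [At [Dt [W [Lt1 [Lt2 [nc lc dec eqv]]]]]]] :=
    assemble ncA ED e0 d0 eqAL EL1 P0 k0 (oner_neq0 _) (oner_neq0 _)
      (@laurent_X_mul_comp K r n L n0 lL) (@laurent_X_mul_exp K r n L lL)
      (size_polyXn _ n) EE EP1.
  exists Q, At, Dt, W, Lt1, Lt2; split=> //; left; exists L, r, n; split=> //.
  by rewrite -ratXnE in eqv.
have [a [b [a0 b0 EPk]]] := binomial_case k0 d0 u0 v0.
rewrite -/g -EP in EPk.
pose m := (k %/ g)%N.
have kg : (m * g)%N = k by rewrite divnK // dvdn_gcdl.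
have m0 : (0 < m)%N by move: k0; rewrite -kg muln_gt0 => /andP[].
have ncG : nonconstant (@ratD K m).
  move=> [w Ew]; apply: ncPX; exists (a * w).
  by rewrite EPk -/m Ew rat_compC ?rmorphM //; apply: nonconstant_scaleXn.
have EE : (chebT K n)%:F \oR ratD m = ratD m \oR ratX ^+ n.
  by rewrite rat_comp_polyl // horner_rat_chebT ratD_comp.
have [Q [At [Dt [W [Lt1 [Lt2 [nc lc dec eqv]]]]]]] :=
  assemble ncA ED e0 d0 eqAL EL1 P0 k0 a0 b0 (@laurent_ratD K m) (@laurent_ratD K m)
    (@size_chebT K n) EE EPk.
exists Q, At, Dt, W, Lt1, Lt2; split=> //; right; exists n, m; split=> //.
by rewrite /coprime -(eqn_pmul2r g0) mul1n muln_gcdl kg dn /g eqxx.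
Qed.

Theorem theorem6p4 (R : realType) (A D : {poly R[i]}) (L1 L2 : ratfun R[i])
    (ncA : nonconstant A%:F) (ncD : nonconstant D%:F)
    (ncL1 : nonconstant L1) (ncL2 : nonconstant L2)
    (laurL1 : laurent L1) (laurL2 : laurent L2)
    (npL1 : ~ is_poly L1) (npL2 : ~ is_poly L2)
    (eqAL : A%:F \oR L1 = L2 \oR D%:F) :
  exists (Q At Dt W : {poly R[i]}) (Lt1 Lt2 : ratfun R[i]),
    [/\ [/\ nonconstant Q%:F, nonconstant At%:F, nonconstant Dt%:F
          & nonconstant W%:F],
        [/\ nonconstant Lt1, nonconstant Lt2, laurent Lt1 & laurent Lt2],
        [/\ A = Q \Po At, L2 = Q%:F \oR Lt2, L1 = Lt1 \oR W%:F, D = Dt \Po W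
          & At%:F \oR Lt1 = Lt2 \oR Dt%:F]
      & (exists (L : ratfun R[i]) (r n : nat),
           [/\ nonconstant L, laurent L, (1 <= n)%N, coprime r n
             & equiv_decomp At%:F Lt1 (ratX ^+ n) (ratX ^+ r * (L \oR ratX ^+ n))
               /\ equiv_decomp Lt2 Dt%:F (ratX ^+ r * L ^+ n) (ratX ^+ n)])
        \/
        (exists (T : {poly R[i]}) (n m : nat),
           [/\ chebyshev n T, (1 <= n)%N, (1 <= m)%N, coprime m n
             & equiv_decomp At%:F Lt1 T%:F (ratD m)
               /\ equiv_decomp Lt2 Dt%:F (ratD m) (ratX ^+ n)])].
Proof.
have [Q [At [Dt [W [Lt1 [Lt2 [nc lc dec []]]]]]]] :=
  laurent_composition ncA ncD ncL1 laurL1 laurL2 npL1 npL2 eqAL.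
  by move=> pow; exists Q, At, Dt, W, Lt1, Lt2; split=> //; left.
move=> [n [m [n0 m0 cop eqv]]].
exists Q, At, Dt, W, Lt1, Lt2; split=> //; right.
by exists (chebT _ n), n, m; split=> //; exact: chebyshev_chebT.
Qed.
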